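(* Let $h,g\in\mathcal F$ be nonzero and $f=h\circ g$. Then $$\{\beta\in\ker f^\ast:\langle\alpha,\beta\rangle_f=0\ \text{for all }\alpha\in\ker g\}=\ker h^\ast.$$
   Context: Let $p$ be a prime, $q$ a power of $p$, and $C$ an algebraically closed field containing $\mathbb F_q$, complete with respect to a non-archimedean absolute value. $\mathcal F$ is the set of formal sums $f=\sum_{n\in\mathbb Z}a_n\tau^n$ ($a_n\in C$) such that $f(z)=\sum_na_nz^{q^n}$ converges for all $z\in C$; it is a ring under termwise addition and composition $(\sum a_i\tau^i)\circ(\sum b_j\tau^j)=\sum_n(\sum_{i+j=n}a_ib_j^{q^i})\tau^n$ (composition of maps), with $c\in C$ identified with multiplication by $c$. $\ker f=\{z\in C:f(z)=0\}$. The adjoint is $f^\ast=\sum_na_n^{1/q^n}\tau^{-n}$. For nonzero $f$ and $\alpha\in\ker f$, $g_\alpha\in\mathcal F$ is the unique element with $f\circ\alpha=g_\alpha\circ(1-\tau)$, and $\langle\alpha,\beta\rangle_f=g_\alpha^\ast(\beta)\in\mathbb F_q$ for $\beta\in\ker f^\ast$. *)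

(* Defs.v *)
From HB Require Import structures.
From mathcomp Require Import all_boot all_order all_algebra.
From mathcomp Require Import boolp classical_sets reals.

Set Implicit Arguments.
Unset Strict Implicit.
Unset Printing Implicit Defensive.
Import Order.TTheory GRing.Theory Num.Theory.
Local Open Scope classical_set_scope.
Local Open Scope ring_scope.

(* The library's normed Z-modules require `|x *+ n| = `|x| *+ n, which fails in
   positive characteristic, so the absolute value is a plain function C -> R. *)
Record nonarch_abs (R : realType) (C : fieldType) (abs : C -> R) : Prop := {
  nonarch_abs_ge0 : forall x, 0 <= abs x ;
  nonarch_abs_eq0 : forall x, abs x = 0 <-> x = 0 ;
  nonarch_absM : forall x y, abs (x * y) = abs x * abs y ;
  nonarch_absD : forall x y, abs (x + y) <= Num.max (abs x) (abs y)
}.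

Section Convergence.
Variables (R : realType) (C : fieldType) (abs : C -> R).

Definition abs_cauchy (u : nat -> C) : Prop :=
  forall eps : R, 0 < eps ->
    exists N : nat, forall m n, (N <= m)%N -> (N <= n)%N ->
      abs (u m - u n) < eps.

Definition abs_cvg_to (u : nat -> C) (l : C) : Prop :=
  forall eps : R, 0 < eps ->
    exists N : nat, forall n, (N <= n)%N -> abs (u n - l) < eps.

Definition abs_complete : Prop :=
  forall u, abs_cauchy u -> exists l, abs_cvg_to u l.

(* Since Negz k = - k.+1, this is the sum of u i over - m <= i < n. *)
Definition zpsum (u : int -> C) (m n : nat) : C :=
  \sum_(k < m) u (Negz k) + \sum_(k < n) u (Posz k).

(* The two ends of a series indexed by Z go to infinity independently. *)
Definition zsum_to (u : int -> C) (l : C) : Prop :=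
  forall eps : R, 0 < eps ->
    exists N : nat, forall m n, (N <= m)%N -> (N <= n)%N ->
      abs (zpsum u m n - l) < eps.

(* 0 if the series diverges. *)
Definition zsum (u : int -> C) : C := xget 0 [set l | zsum_to u l].

End Convergence.

Section TauSeries.
Variables (R : realType) (C : fieldType) (abs : C -> R) (q : nat).

(* x ^ (q ^ n) for n : int; for n < 0 this is the q^(-n)-th root, which exists
   and is unique when C is algebraically closed and q is a power of its
   characteristic. *)
Definition qpow (n : int) (x : C) : C :=
  match n with
  | Posz m => x ^+ (q ^ m)
  | Negz m => xget 0 [set y | y ^+ (q ^ m.+1) = x]
  end.

(* a : int -> C stands for the formal sum of the a n tau^n. *)
Definition tau_terms (a : int -> C) (z : C) : int -> C :=
  fun n => a n * qpow n z.

Definition tauF : set (int -> C) :=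
  [set a | forall z, exists l, zsum_to abs (tau_terms a z) l].

Definition tau_eval (a : int -> C) (z : C) : C := zsum abs (tau_terms a z).

Definition tau_ker (a : int -> C) : set C := [set z | tau_eval a z = 0].

Definition tau_comp (a b : int -> C) : int -> C :=
  fun n => zsum abs (fun i => a i * qpow i (b (n - i))).

Definition tau_const (c : C) : int -> C := fun n => if n == 0 then c else 0.

Definition one_sub_tau : int -> C :=
  fun n => if n == 0 then 1 else if n == 1 then - 1 else 0.

(* The term a_m^(1/q^m) tau^(-m) is listed at index n = - m. *)
Definition tau_adj (a : int -> C) : int -> C := fun n => qpow n (a (- n)).

Definition tau_galpha (f : int -> C) (alpha : C) : int -> C :=
  xget (fun=> 0)
    [set g | tauF g /\ tau_comp f (tau_const alpha) = tau_comp g one_sub_tau].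

(* The value lies in the copy of F_q inside C and is kept in C. *)
Definition tau_pairing (f : int -> C) (alpha beta : C) : C :=
  tau_eval (tau_adj (tau_galpha f alpha)) beta.

End TauSeries.

(* Main.v *)
Require Import Defs.
From HB Require Import structures.
From mathcomp Require Import all_boot all_order all_algebra finfield.
From mathcomp Require Import boolp classical_sets reals.
From mathcomp Require Import zify ring lra.

Set Implicit Arguments.
Unset Strict Implicit.
Unset Printing Implicit Defensive.
Import Order.TTheory GRing.Theory Num.Theory.
Local Open Scope classical_set_scope.
Local Open Scope ring_scope.

(* For alpha in ker g, uniqueness of g_alpha gives g_alpha(f) = h o g_alpha(g), hence
   <alpha, beta>_f = <alpha, h^* beta>_g; also f^* = g^* o h^*.  So ker h^* is contained
   in the left-hand side, and the converse says that no nonzero gamma in ker g^* pairs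
   to zero with all of ker g.  For that, gamma g = (1 - tau^-1) k for some nonzero k in
   the ring, and <alpha, gamma>_g is k(alpha) up to sign and a q-th root.  Every nonzero
   element of the ring is surjective on C (successive approximation, solving a polynomial
   truncation at each step by its smallest root), so k(alpha) = 1 for some alpha, and then
   gamma g(alpha) = 1 - 1 = 0.

   Two-sided series and double series are handled as unordered sums: over an ultrametric
   field a family is summable as soon as it tends to 0 off finite sets. *)

(** * Unordered sums in an ultrametric field *)

Section UltrametricSums.
Variables (R : realType) (C : fieldType) (abs : C -> R).
Hypothesis habs : nonarch_abs abs.

Let abs_ge0 := nonarch_abs_ge0 habs.
Let absM := nonarch_absM habs.

Lemma abs0 : abs 0 = 0.
Proof. exact/(nonarch_abs_eq0 habs). Qed.

Lemma abs_gt0 x : x != 0 -> 0 < abs x.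
Proof.
move=> x0; rewrite lt_neqAle abs_ge0 andbT eq_sym; apply/eqP => /(nonarch_abs_eq0 habs) xE.
by rewrite xE eqxx in x0.
Qed.

Lemma abs1 : abs 1 = 1.
Proof.
have n0 : abs 1 != 0 by rewrite gt_eqF // abs_gt0 ?oner_neq0.
by apply: (mulfI n0); rewrite -absM !mulr1.
Qed.

Lemma absX x k : abs (x ^+ k) = abs x ^+ k.
Proof. by elim: k => [|k IH]; rewrite ?expr0 ?abs1 // !exprS absM IH. Qed.

Lemma absN x : abs (- x) = abs x.
Proof.
have s : abs (-1) ^+ 2 = 1 ^+ 2 by rewrite -absX sqrrN !expr1n abs1.
have n1 : abs (-1) = 1 by apply/eqP; rewrite -(eqrXn2 (_ : 0 < 2)%N) ?s.
by rewrite -mulN1r absM n1 mul1r.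
Qed.

Lemma absD_lt eps x y : abs x < eps -> abs y < eps -> abs (x + y) < eps.
Proof.
by move=> hx hy; apply: le_lt_trans (nonarch_absD habs x y) _; rewrite gt_max hx.
Qed.

Lemma absB_lt eps x y : abs x < eps -> abs y < eps -> abs (x - y) < eps.
Proof. by move=> hx hy; apply: absD_lt; rewrite ?absN. Qed.

Lemma abs_sum_lt (I : eqType) (s : seq I) (P : pred I) (u : I -> C) eps : 0 < eps ->
  (forall i, i \in s -> P i -> abs (u i) < eps) -> abs (\sum_(i <- s | P i) u i) < eps.
Proof.
move=> e0 us; rewrite big_seq_cond; elim/big_ind: _ => [|x y|i /andP[]].
- by rewrite abs0.
- exact: absD_lt.
- exact: us.
Qed.

Definition vanishing (I : eqType) (u : I -> C) : Prop :=
  forall eps, 0 < eps -> exists A : seq I, forall i, i \notin A -> abs (u i) < eps.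

(** One finite set [A] per [eps] is enough, because the terms outside [A] are required to be small
    as well: by the ultrametric inequality, any other finite set with small complement then has a
    partial sum within [eps] of [l], as [has_sum_approx] records. *)
Definition has_sum (I : eqType) (u : I -> C) (l : C) : Prop :=
  forall eps, 0 < eps -> exists A : seq I,
    [/\ uniq A, forall i, i \notin A -> abs (u i) < eps & abs (\sum_(i <- A) u i - l) < eps].

Lemma has_sum_vanishing (I : eqType) (u : I -> C) l : has_sum u l -> vanishing u.
Proof. by move=> us eps /us[A [_ uA _]]; exists A. Qed.

Lemma eq_has_sum (I : eqType) (u v : I -> C) l : u =1 v -> has_sum u l -> has_sum v l.
Proof. by move=> /funext->. Qed.

(** The terms over the intersection cancel; what remains of each sum lies outside the other set,
    hence is small. *)
Lemma partial_sums_close (I : eqType) (u : I -> C) (A B : seq I) eps : 0 < eps ->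
  uniq A -> uniq B -> (forall i, i \notin A -> abs (u i) < eps) ->
  (forall i, i \notin B -> abs (u i) < eps) ->
  abs (\sum_(i <- A) u i - \sum_(i <- B) u i) < eps.
Proof.
move=> e0 Au Bu uA uB; rewrite (bigID (mem B)) [X in _ - X](bigID (mem A)) /=.
have -> : \sum_(i <- A | i \in B) u i = \sum_(i <- B | i \in A) u i.
  rewrite -big_filter -[RHS]big_filter; apply/perm_big/uniq_perm.
  - exact: filter_uniq.
  - exact: filter_uniq.
  - by move=> i; rewrite !mem_filter andbC.
rewrite opprD addrACA subrr add0r; apply: absB_lt.
- by apply: abs_sum_lt => // i _ /uB.
- by apply: abs_sum_lt => // i _ /uA.
Qed.

Lemma has_sum_approx (I : eqType) (u : I -> C) l eps (A : seq I) : has_sum u l ->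
  0 < eps -> uniq A -> (forall i, i \notin A -> abs (u i) < eps) ->
  abs (\sum_(i <- A) u i - l) < eps.
Proof.
move=> us e0 Au uA; have [B [Bu uB lB]] := us _ e0.
rewrite -(subrKA (\sum_(i <- B) u i)); apply: absD_lt => //.
exact: partial_sums_close.
Qed.

Lemma abs_has_sum_lt (I : eqType) (u : I -> C) l eps : has_sum u l -> 0 < eps ->
  (forall i, abs (u i) < eps) -> abs l < eps.
Proof.
move=> us e0 ue; rewrite -absN -[- l]add0r -(big_nil 0 +%R xpredT u).
exact: has_sum_approx.
Qed.

Lemma abs_eq_small x y : (forall eps, 0 < eps -> abs (x - y) < eps) -> x = y.
Proof.
move=> xy; apply/eqP; rewrite -subr_eq0; apply/negPn/negP => /abs_gt0 /xy.
by rewrite ltxx.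
Qed.

Lemma has_sum_unique (I : eqType) (u : I -> C) l l' : has_sum u l -> has_sum u l' -> l = l'.
Proof.
move=> ul ul'; apply: abs_eq_small => eps e0.
have [A [Au uA lA]] := ul _ e0.
rewrite -(subrKA (\sum_(i <- A) u i)); apply: absD_lt; last exact: has_sum_approx.
by rewrite -absN opprB.
Qed.

Lemma inv_nat_small (eps : R) : 0 < eps -> exists n : nat, n.+1%:R^-1 < eps.
Proof.
move=> e0; exists (Num.bound eps^-1).
have := archi_boundP (ltW (_ : 0 < eps^-1)); rewrite invr_gt0 => /(_ e0) b.
rewrite invf_plt ?posrE ?ltr0n //; apply: lt_trans b _.
by rewrite ltr_nat.
Qed.

(** The exceptional sets for the thresholds 1/(n+1) have Cauchy partial sums. They need not be
    nested, since [partial_sums_close] compares any two of them. *)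
Lemma vanishing_has_sum (I : eqType) (u : I -> C) : abs_complete abs -> vanishing u ->
  exists l, has_sum u l.
Proof.
move=> hc uv.
have /choice[A hA] : forall n : nat, exists A : seq I,
    uniq A /\ forall i, i \notin A -> abs (u i) < n.+1%:R^-1.
  move=> n; have [|A uA] := uv n.+1%:R^-1; first by rewrite invr_gt0 ltr0n.
  by exists (undup A); split; [exact: undup_uniq | move=> i; rewrite mem_undup; exact: uA].
have mono eps N n : N.+1%:R^-1 < eps -> (N <= n)%N -> n.+1%:R^-1 < eps :> R.
  by move=> h Nn; apply: le_lt_trans h; rewrite lef_pV2 ?posrE ?ltr0n // ler_nat.
have [|l hl] := hc (fun n => \sum_(i <- A n) u i).
  move=> eps e0; have [N hN] := inv_nat_small e0; exists N => m n Nm Nn.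
  apply: partial_sums_close; rewrite ?(hA _).1 // => i /(hA _).2 h.
  - exact: lt_trans h (mono _ _ _ hN Nm).
  - exact: lt_trans h (mono _ _ _ hN Nn).
exists l => eps e0; have [N1 hN1] := inv_nat_small e0; have [N2 hN2] := hl _ e0.
exists (A (maxn N1 N2)); split; first by rewrite (hA _).1.
- by move=> i /(hA _).2 h; apply: lt_trans h (mono _ _ _ hN1 (leq_maxl _ _)).
- exact/hN2/leq_maxr.
Qed.

Lemma vanishing_dominated (I : eqType) (u v : I -> C) : vanishing u ->
  (forall i, abs (v i) <= abs (u i)) -> vanishing v.
Proof.
move=> us vu eps /us[A uA]; exists A => i /uA; exact/le_lt_trans.
Qed.

Lemma vanishingD (I : eqType) (u v : I -> C) :
  vanishing u -> vanishing v -> vanishing (fun i => u i + v i).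
Proof.
move=> us vs eps e0; have [A uA] := us _ e0; have [B vB] := vs _ e0.
exists (A ++ B) => i; rewrite mem_cat negb_or => /andP[/uA ui /vB vi].
exact: absD_lt.
Qed.

(** An additive map continuous at 0 commutes with sums; this serves for scalar multiplication,
    negation and the maps [qpow q n]. *)
Lemma has_sum_additive (I : eqType) (phi : C -> C) (u : I -> C) l :
  phi 0 = 0 -> {morph phi : x y / x + y} ->
  (forall eps, 0 < eps ->
     exists2 delta, 0 < delta & forall x, abs x < delta -> abs (phi x) < eps) ->
  has_sum u l -> has_sum (fun i => phi (u i)) (phi l).
Proof.
move=> phi0 phiD phic us eps e0; have [d d0 hd] := phic _ e0.
have phiN x : phi (- x) = - phi x.
  by apply/eqP; rewrite -addr_eq0 -phiD addNr phi0.
have [A [Au uA lA]] := us _ d0; exists A; split => //.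
- by move=> i /uA /hd.
- by rewrite -(big_morph phi phiD phi0) -phiN -phiD; exact: hd.
Qed.

Lemma mulr_small (c : C) eps : 0 < eps ->
  exists2 delta, 0 < delta & forall x, abs x < delta -> abs (c * x) < eps.
Proof.
(* Adding 1 keeps the divisor positive when [c] is 0. *)
move=> e0; have c1 : 0 < abs c + 1 by rewrite ltr_wpDl.
exists (eps / (abs c + 1)); first exact: divr_gt0.
move=> x; rewrite ltr_pdivlMr // absM mulrC; apply: le_lt_trans.
by rewrite ler_wpM2r // lerDl.
Qed.

Lemma has_sumMl (I : eqType) (c : C) (u : I -> C) l :
  has_sum u l -> has_sum (fun i => c * u i) (c * l).
Proof.
apply: (@has_sum_additive _ ( *%R c)); [exact: mulr0 | exact: mulrDr | exact: mulr_small].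
Qed.

Lemma vanishingMl (I : eqType) (c : C) (u : I -> C) :
  vanishing u -> vanishing (fun i => c * u i).
Proof.
move=> us eps e0; have [d d0 hd] := mulr_small c e0.
by have [A uA] := us _ d0; exists A => i /uA /hd.
Qed.

Lemma has_sumN (I : eqType) (u : I -> C) l :
  has_sum u l -> has_sum (fun i => - u i) (- l).
Proof.
apply: (@has_sum_additive _ -%R); [exact: oppr0 | exact: opprD |].
by move=> eps e0; exists eps => // x; rewrite absN.
Qed.

Lemma has_sumD (I : eqType) (u v : I -> C) l m :
  has_sum u l -> has_sum v m -> has_sum (fun i => u i + v i) (l + m).
Proof.
move=> us vs eps e0; have [A [Au uA lA]] := us _ e0; have [B [Bu vB mB]] := vs _ e0.
have uAB i : i \notin undup (A ++ B) -> abs (u i) < eps /\ abs (v i) < eps.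
  by rewrite mem_undup mem_cat negb_or => /andP[/uA ? /vB].
exists (undup (A ++ B)); split; first exact: undup_uniq.
- by move=> i /uAB[ui vi]; exact: absD_lt.
- rewrite big_split opprD addrACA; apply: absD_lt.
  + by apply: has_sum_approx; rewrite ?undup_uniq // => i /uAB[].
  + by apply: has_sum_approx; rewrite ?undup_uniq // => i /uAB[].
Qed.

Lemma has_sumB (I : eqType) (u v : I -> C) l m :
  has_sum u l -> has_sum v m -> has_sum (fun i => u i - v i) (l - m).
Proof. by move=> us vs; apply: has_sumD => //; exact: has_sumN. Qed.

Lemma has_sum_single (I : eqType) (i0 : I) (x : C) :
  has_sum (fun i => if i == i0 then x else 0) x.
Proof.
move=> eps e0; exists [:: i0]; split=> //.
- by move=> i; rewrite inE => /negPf->; rewrite abs0.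
- by rewrite big_seq1 eqxx subrr abs0.
Qed.

Lemma has_sum_bij (I J : eqType) (phi : J -> I) (psi : I -> J) (u : I -> C) l :
  cancel phi psi -> cancel psi phi -> has_sum u l -> has_sum (fun j => u (phi j)) l.
Proof.
move=> phiK psiK us eps e0; have [A [Au uA lA]] := us _ e0.
exists [seq psi i | i <- A]; split.
- by rewrite map_inj_uniq //; exact: can_inj psiK.
- by move=> j jA; apply: uA; apply: contra jA => jA; apply/mapP; exists (phi j).
- by rewrite big_map; under eq_bigr do rewrite psiK.
Qed.

Lemma vanishing_inj (I J : eqType) (phi : J -> I) (psi : I -> J) (u : I -> C) :
  cancel phi psi -> vanishing u -> vanishing (fun j => u (phi j)).
Proof.
move=> phiK us eps e0; have [A uA] := us _ e0.
exists [seq psi i | i <- A] => j jA; apply: uA.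
by apply: contra jA => jA; apply/mapP; exists (phi j).
Qed.

(** Enclose the exceptional set in the rectangle [A1] x [A2] of its projections. The sum over the
    rectangle is close to [l], and also to the sum of the row sums over [A1], since each row is
    small off [A2]. *)
Lemma has_sum_fubini (I J : eqType) (u : I * J -> C) (s : I -> C) l :
  has_sum u l -> (forall i, has_sum (fun j => u (i, j)) (s i)) -> has_sum s l.
Proof.
move=> us rs eps e0; have [A [Au uA lA]] := us _ e0.
pose A1 := undup [seq x.1 | x <- A]; pose A2 := undup [seq x.2 | x <- A].
have mem12 x : x \in A -> (x.1 \in A1) && (x.2 \in A2).
  by move=> xA; rewrite !mem_undup !map_f.
have out1 i j : i \notin A1 -> abs (u (i, j)) < eps.
  by move=> iA; apply: uA; apply: contra iA => /mem12 /andP[].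
have out2 i j : j \notin A2 -> abs (u (i, j)) < eps.
  by move=> iA; apply: uA; apply: contra iA => /mem12 /andP[].
exists A1; split; first exact: undup_uniq.
- by move=> i iA; apply: (abs_has_sum_lt (rs i)) => // j; exact: out1.
rewrite -(subrKA (\sum_(i <- A1) \sum_(j <- A2) u (i, j))) -sumrB; apply: absD_lt.
  apply: abs_sum_lt => // i _ _; rewrite -absN opprB; apply: has_sum_approx => //.
  - exact: undup_uniq.
  - by move=> j; exact: out2.
rewrite -(big_allpairs (r1 := A1) (r2 := A2) (F := u)).
apply: has_sum_approx => //.
- by rewrite allpairs_uniq ?undup_uniq // => -[? ?] [? ?].
- move=> [i j] ij; apply: uA; apply: contra ij => /mem12 /andP[/= i1 j2].
  exact: allpairs_f.
Qed.

(** * Sums indexed by the integers *)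

Definition zbox (m n : nat) : seq int :=
  [seq Negz k | k <- iota 0 m] ++ [seq Posz k | k <- iota 0 n].

Lemma zpsumE (u : int -> C) m n : zpsum u m n = \sum_(i <- zbox m n) u i.
Proof.
rewrite big_cat !big_map /zpsum -(big_mkord xpredT (fun k => u (Negz k))).
by rewrite -(big_mkord xpredT (fun k => u (Posz k))) /index_iota !subn0.
Qed.

Lemma zbox_uniq m n : uniq (zbox m n).
Proof.
rewrite cat_uniq !map_inj_uniq ?iota_uniq ?andbT /=; try by move=> ? ? [].
by apply/hasP => -[x /mapP[k _ ->] /mapP[]].
Qed.

Lemma mem_zboxP N m n i : (N <= m)%N -> (N <= n)%N -> i \notin zbox m n -> (N <= `|i|)%N.
Proof.
move=> Nm Nn; rewrite mem_cat negb_or => /andP[i1 i2]; rewrite leqNgt; apply/negP => iN.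
case: i i1 i2 iN => k i1 i2 iN.
- by case/negP: i2; apply/mapP; exists k => //; rewrite mem_iota; lia.
- by case/negP: i1; apply/mapP; exists k => //; rewrite mem_iota; lia.
Qed.

Lemma seq_int_bounded (A : seq int) : exists N, forall i, (N <= `|i|)%N -> i \notin A.
Proof.
elim: A => [|a A [N hN]]; first by exists 0%N.
exists (maxn N (`|a|).+1) => i; rewrite geq_max => /andP[Ni ai].
rewrite inE negb_or hN // andbT; apply/eqP => ia; rewrite ia in ai; lia.
Qed.

Lemma vanishing_intP (u : int -> C) : vanishing u <->
  forall eps, 0 < eps -> exists N, forall i, (N <= `|i|)%N -> abs (u i) < eps.
Proof.
split=> us eps /us[A uA].
- by have [N hN] := seq_int_bounded A; exists N => i /hN /uA.
- by exists (zbox A A) => i /(mem_zboxP (leqnn _) (leqnn _)) /uA.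
Qed.

(** From left to right, a single term is the difference of two partial sums that differ at one end
    only; this is where the independence of the two ends enters. *)
Lemma zsum_to_has_sum (u : int -> C) l : zsum_to abs u l <-> has_sum u l.
Proof.
split=> us eps e0; last first.
  have [A [_ uA _]] := us _ e0; have [N hN] := seq_int_bounded A; exists N => m n Nm Nn.
  rewrite zpsumE; apply: has_sum_approx => //; first exact: zbox_uniq.
  by move=> i /(mem_zboxP Nm Nn) /hN /uA.
(* The size is [N.+1] because [Negz k] has absolute value [k.+1], while [N <= k] is needed. *)
have [N hN] := us _ e0; exists (zbox N.+1 N.+1); split; first exact: zbox_uniq.
- move=> i /(mem_zboxP (leqnn _) (leqnn _)); case: i => k Nk.
  + have -> : u (Posz k) = (zpsum u N k.+1 - l) - (zpsum u N k - l).
      by rewrite /zpsum big_ord_recr /=; ring.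
    by apply: absB_lt; apply: hN => //; move: Nk => /=; lia.
  + have -> : u (Negz k) = (zpsum u k.+1 N - l) - (zpsum u k N - l).
      by rewrite /zpsum big_ord_recr /=; ring.
    by apply: absB_lt; apply: hN => //; move: Nk => /=; lia.
- by rewrite -zpsumE; apply: hN.
Qed.

Lemma zsumP (u : int -> C) l : has_sum u l -> zsum abs u = l.
Proof.
move=> us; apply: xget_unique; first exact/zsum_to_has_sum.
by move=> y /zsum_to_has_sum yl; exact: has_sum_unique yl us.
Qed.

Lemma has_sum_zsum (u : int -> C) : abs_complete abs -> vanishing u ->
  has_sum u (zsum abs u).
Proof. by move=> hc /(vanishing_has_sum hc)[l ul]; rewrite (zsumP ul). Qed.

(** Right multiplication by 1 - tau is injective: a constant family of coefficients that tends to 0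
    is zero. *)
Lemma vanishing_const0 (D : int -> C) : vanishing D ->
  (forall n, D n = D (n - 1)) -> D = fun=> 0.
Proof.
move=> /vanishing_intP Ds DE.
have shift n (k : nat) : D (n + k%:Z) = D n.
  elim: k => [|k IH]; first by rewrite addr0.
  by rewrite DE -IH; congr D; lia.
apply: funext => n; apply: abs_eq_small => eps /Ds[N hN]; rewrite subr0.
rewrite -(shift n (`|n| + N)%N); apply: hN; lia.
Qed.

Lemma has_sum_telescope (w : nat -> C) :
  (forall eps, 0 < eps -> exists N, forall k, (N <= k)%N -> abs (w k) < eps) ->
  has_sum (fun k => w k - w k.+1) (w 0%N).
Proof.
move=> ws eps e0; have [N hN] := ws _ e0.
exists (iota 0 N); split; first exact: iota_uniq.
- move=> k; rewrite mem_iota /= -leqNgt => Nk; apply: absB_lt; apply: hN => //.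
  exact: leqW.
- have -> : \sum_(k <- iota 0 N) (w k - w k.+1) = w 0%N - w N.
    elim: (N) => [|n IH]; first by rewrite big_nil subrr.
    by rewrite -addn1 iotaD big_cat IH big_seq1 /= addn1; ring.
  by rewrite addrAC subrr add0r absN hN.
Qed.

End UltrametricSums.

(** * Small roots of polynomials *)

Section SmallRoots.
Variables (C : closedFieldType) (R : realType) (abs : C -> R).
Hypothesis habs : nonarch_abs abs.
Let abs_ge0 := nonarch_abs_ge0 habs.

(** A Newton polygon estimate, by induction on the roots: a factor X - y with [abs y] > r multiplies
    the size of the constant coefficient by [abs y], and both contributions to a higher coefficient,
    weighted by the power of r, stay strictly below the result. *)
Lemma abs_prod_XsubC_coef (s : seq C) (r : R) k : 0 <= r ->
  (forall y, y \in s -> r < abs y) -> (0 < k)%N ->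
  abs (\prod_(y <- s) ('X - y%:P))`_k * r ^+ k < abs (\prod_(y <- s) ('X - y%:P))`_0.
Proof.
move=> r0; elim: s k => [|y s IH] k sr k0.
  by rewrite big_nil !coef1 gtn_eqF // (abs0 habs) mul0r (abs1 habs) ltr01.
have {}IH j := IH j (fun z (zs : z \in s) => sr z (mem_behead (s := y :: s) zs)).
have {sr} ry : r < abs y by apply: sr; rewrite inE eqxx.
rewrite big_cons; move: IH; set P := \prod_(_ <- s) _ => IH.
have P0 : 0 < abs P`_0 by apply: le_lt_trans (IH 1%N isT); rewrite mulr_ge0.
have IHw j : abs P`_j * r ^+ j <= abs P`_0.
  by case: j => [|j]; [rewrite expr0 mulr1 | exact/ltW/IH].
case: k k0 => // k _; rewrite mulrBl !coefB !coefXM !coefCM /= sub0r (absN habs).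
have y0 := le_lt_trans r0 ry.
have -> : r ^+ k.+1 = r ^+ k * r by rewrite exprSr.
apply: le_lt_trans (_ : Num.max (abs P`_k) (abs (y * P`_k.+1)) * (r ^+ k * r) < _).
  rewrite ler_wpM2r ?mulr_ge0 ?exprn_ge0 //.
  by rewrite -(absN habs (y * _)); exact: nonarch_absD habs _ _.
rewrite !(nonarch_absM habs); have [_|_] := leP (abs P`_k) (abs y * abs P`_k.+1).
- by rewrite -mulrA ltr_pM2l // -exprSr; exact: IH.
- rewrite mulrA mulrC; apply: le_lt_trans (_ : r * abs P`_0 < _).
    by rewrite ler_wpM2l.
  by rewrite ltr_pM2r.
Qed.

(** If all roots lay outside the disc of radius [r], splitting [P] into linear factors would make
    its constant coefficient strictly dominant. *)
Lemma small_root (P : {poly C}) (r : R) k : 0 <= r -> P != 0 -> (0 < k)%N ->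
  abs P`_0 <= abs P`_k * r ^+ k -> exists2 y, root P y & abs y <= r.
Proof.
move=> r0 P0 k0 Pk; apply/not_exists2P => nroot.
have [s Ps] := closed_field_poly_normal P.
have sr y : y \in s -> r < abs y.
  move=> ys; rewrite ltNge; apply/negP => yr; case: (nroot y) => // -[].
  by rewrite Ps rootZ ?lead_coef_eq0 // root_prod_XsubC.
have := abs_prod_XsubC_coef r0 sr k0.
have lc0 : 0 < abs (lead_coef P) by rewrite (abs_gt0 habs) // lead_coef_eq0.
rewrite -(ltr_pM2l lc0) mulrA -!(nonarch_absM habs) -!coefZ -Ps.
by rewrite ltNge Pk.
Qed.

End SmallRoots.

(** * Series in tau *)

Section TauSeriesTheory.
Variables (C : closedFieldType) (p e q : nat).
Hypotheses (charC : p \in [pchar C]) (hq : q = (p ^ e)%N).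

Let pchar_q k : [pchar C].-nat (q ^ k)%N.
Proof.
have pn : [pchar C].-nat p by rewrite pnatE ?(pcharf_prime charC).
by rewrite hq !pnatX pn.
Qed.

Let q_gt0 : (0 < q)%N.
Proof. by rewrite hq expn_gt0 prime_gt0 // (pcharf_prime charC). Qed.

Let qk_gt0 k : (0 < q ^ k)%N.
Proof. by rewrite expn_gt0 q_gt0. Qed.

(** * Powers of Frobenius with integer exponents *)

Lemma expq_inj k : injective (fun x : C => x ^+ (q ^ k)).
Proof.
move=> x y /eqP; rewrite -subr_eq0 -exprNn_pchar // -exprDn_pchar //.
by rewrite expf_eq0 qk_gt0 subr_eq0 => /eqP.
Qed.

Lemma qpow_root k (x : C) : qpow q (Negz k) x ^+ (q ^ k.+1) = x.
Proof.
suff [y yx] : exists y : C, y ^+ (q ^ k.+1) = x.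
  by apply: (@xgetPex _ 0 [set y | y ^+ (q ^ k.+1) = x]); exists y.
have /closed_rootP[y] : size ('X^(q ^ k.+1) - x%:P) != 1%N.
  by rewrite size_XnsubC // eqSS -lt0n.
by rewrite rootE !hornerE subr_eq0 => /eqP; exists y.
Qed.

(** Clears the roots: identities for [qpow] are checked after raising to a large power q^N, where
    they concern ordinary powers, and [expq_inj] brings them back. *)
Lemma qpow_expE (n : int) (N M : nat) (x : C) : n + N%:Z = M%:Z ->
  qpow q n x ^+ (q ^ N) = x ^+ (q ^ M).
Proof.
case: n => k /= nNM.
- by rewrite -exprM -expnD; congr (_ ^+ (q ^ _)); lia.
- have -> : N = (k.+1 + M)%N by lia.
  by rewrite expnD exprM qpow_root.
Qed.

Let shift_nonneg (n : int) : n + (absz n)%:Z = (absz (n + (absz n)%:Z))%:Z.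
Proof. lia. Qed.

Lemma qpow0 n : qpow q n (0 : C) = 0.
Proof.
apply: (@expq_inj `|n|); rewrite (qpow_expE _ (shift_nonneg n)) !expr0n.
by rewrite !gtn_eqF.
Qed.

Lemma qpow1 n : qpow q n (1 : C) = 1.
Proof. by apply: (@expq_inj `|n|); rewrite (qpow_expE _ (shift_nonneg n)) !expr1n. Qed.

Lemma qpowD n (x y : C) : qpow q n (x + y) = qpow q n x + qpow q n y.
Proof.
apply: (@expq_inj `|n|) => /=.
by rewrite exprDn_pchar // !(qpow_expE _ (shift_nonneg n)) exprDn_pchar.
Qed.

Lemma qpowN n (x : C) : qpow q n (- x) = - qpow q n x.
Proof.
apply: (@expq_inj `|n|) => /=.
by rewrite exprNn_pchar // !(qpow_expE _ (shift_nonneg n)) exprNn_pchar.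
Qed.

Lemma qpowB n (x y : C) : qpow q n (x - y) = qpow q n x - qpow q n y.
Proof. by rewrite qpowD qpowN. Qed.

Lemma qpowM n (x y : C) : qpow q n (x * y) = qpow q n x * qpow q n y.
Proof.
apply: (@expq_inj `|n|) => /=.
by rewrite exprMn !(qpow_expE _ (shift_nonneg n)) exprMn.
Qed.

Lemma qpow_qpow m n (x : C) : qpow q m (qpow q n x) = qpow q (m + n) x.
Proof.
(* One factor q^N clears [m]; the exponent m + 2N that is left is still large enough to clear
   [n]. *)
pose N := (`|m| + `|n|)%N.
have hm : m + N%:Z = (absz (m + N%:Z))%:Z by lia.
have hmn : m + n + (N + N)%N%:Z = (absz (m + n + (N + N)%N%:Z))%:Z by lia.
have hn : n + (absz (m + N%:Z)%R + N)%N%:Z = (absz (m + n + (N + N)%N%:Z))%:Z by lia.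
apply: (@expq_inj (N + N)) => /=.
by rewrite (qpow_expE _ hmn) -(qpow_expE _ hn) expnD exprM (qpow_expE _ hm) -exprM -expnD.
Qed.

Lemma qpow_id (x : C) : qpow q 0 x = x.
Proof. by rewrite /= expn0 expr1. Qed.

Lemma qpowK n : cancel (@qpow C q n) (qpow q (- n)).
Proof. by move=> x; rewrite qpow_qpow addNr qpow_id. Qed.

Lemma qpowKV n : cancel (@qpow C q (- n)) (qpow q n).
Proof. by move=> x; rewrite qpow_qpow addrN qpow_id. Qed.

Variables (R : realType) (abs : C -> R).
Hypothesis habs : nonarch_abs abs.
Let abs_ge0 := nonarch_abs_ge0 habs.

Lemma abs_qpow_le n x y : (abs (qpow q n x) <= abs (qpow q n y)) = (abs x <= abs y).
Proof.
rewrite -(@ler_pXn2r _ (q ^ `|n|)%N) ?nnegrE // -!(absX habs).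
by rewrite !(qpow_expE _ (shift_nonneg n)) !(absX habs) ler_pXn2r ?nnegrE.
Qed.

Lemma abs_qpow_lt n x y : (abs (qpow q n x) < abs (qpow q n y)) = (abs x < abs y).
Proof. by rewrite !ltNge abs_qpow_le. Qed.

Lemma abs_qpow_mono m n x : 1 <= abs x -> m <= n -> abs (qpow q m x) <= abs (qpow q n x).
Proof.
move=> x1 mn; have -> : n = m + (absz (n - m))%:Z by lia.
by rewrite -qpow_qpow abs_qpow_le /= (absX habs) ler_eXnr.
Qed.

Lemma qpow_small n eps : 0 < eps ->
  exists2 delta, 0 < delta & forall x, abs x < delta -> abs (qpow q n x) < eps.
Proof.
move=> e0; case: n => k.
- exists (Num.min eps 1); first by rewrite lt_min e0 ltr01.
  move=> x; rewrite lt_min => /andP[xe x1] /=; rewrite (absX habs).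
  by apply: le_lt_trans xe; rewrite ler_iXnr // ltW.
- exists (eps ^+ (q ^ k.+1)); first exact: exprn_gt0.
  by move=> x; rewrite -{1}(qpow_root k x) (absX habs) ltr_pXn2r ?nnegrE // ltW.
Qed.

Lemma has_sum_qpow (I : eqType) n (u : I -> C) l : has_sum abs u l ->
  has_sum abs (fun i => qpow q n (u i)) (qpow q n l).
Proof.
by move=> us; apply: (has_sum_additive (qpow0 n) (qpowD n) _ us) => eps; exact: qpow_small.
Qed.

Lemma vanishing_qpow (I : eqType) n (u : I -> C) : vanishing abs u ->
  vanishing abs (fun i => qpow q n (u i)).
Proof.
move=> us eps /(qpow_small n)[d d0 hd].
by have [A uA] := us _ d0; exists A => i /uA /hd.
Qed.

Hypothesis hcomplete : abs_complete abs.

(** * Evaluation and composition of series *)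

Lemma tauFP a : tauF abs q a <-> forall z, vanishing abs (tau_terms q a z).
Proof.
split=> aF z.
- by have [l /(zsum_to_has_sum habs)/has_sum_vanishing] := aF z.
- by have [l /(zsum_to_has_sum habs)] := vanishing_has_sum habs hcomplete (aF z); exists l.
Qed.

Lemma tau_evalP a z : tauF abs q a -> has_sum abs (tau_terms q a z) (tau_eval abs q a z).
Proof. by move=> /tauFP aF; exact: has_sum_zsum. Qed.

Lemma vanishing_coef a : tauF abs q a -> vanishing abs a.
Proof.
move=> /tauFP/(_ 1); rewrite (_ : tau_terms q a 1 = a) //.
by apply: funext => n; rewrite /tau_terms qpow1 mulr1.
Qed.

(** The bound is the absolute value of an element of the field, so that a series can be evaluated at
    that element. *)
Lemma vanishing_bounded (J : eqType) (b : J -> C) : vanishing abs b ->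
  exists w, forall j, abs (b j) <= abs w.
Proof.
case/(_ 1 ltr01) => A bA.
have [w [w1 hw]] : exists w, 1 <= abs w /\ forall j, j \in A -> abs (b j) <= abs w.
  elim: A {bA} => [|j A [w [w1 hw]]]; first by exists 1; rewrite (abs1 habs).
  have [jw|wj] := leP (abs (b j)) (abs w).
  - by exists w; split=> // i; rewrite inE => /predU1P[->|/hw].
  - exists (b j); split; first exact: le_trans (ltW wj).
    by move=> i; rewrite inE => /predU1P[->|/hw /le_trans] //; apply; exact: ltW.
exists w => j; have [/hw//|/bA bj] := boolP (j \in A).
exact/ltW/(lt_le_trans bj).
Qed.

(** With [w] bounding all the [b j], convergence of [a] at [w] makes the terms small for all but
    finitely many i, uniformly in j. For each remaining i, continuity of [qpow q i] excludes only
    finitely many j. *)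
Lemma vanishing_tau_terms2 (J : eqType) a (b : J -> C) : tauF abs q a -> vanishing abs b ->
  vanishing abs (fun x => a x.1 * qpow q x.1 (b x.2)).
Proof.
move=> /tauFP aF bs eps e0; have [w bw] := vanishing_bounded bs.
have [A aA] := aF w _ e0.
have [B hB] : exists B : seq J, forall i j, i \in A -> j \notin B ->
    abs (a i * qpow q i (b j)) < eps.
  elim: A {aA} => [|i A [B hB]]; first by exists [::].
  have [B' hB'] := vanishingMl habs (a i) (vanishing_qpow i bs) e0.
  exists (B ++ B') => k j; rewrite inE mem_cat negb_or => /predU1P[->|kA] /andP[jB jB'].
  - exact: hB'.
  - exact: hB.
exists [seq (i, j) | i <- A, j <- B] => -[i j] ij /=.
have [iA|/aA] := boolP (i \in A).
- by apply: hB => //; apply: contra ij => jB; exact: allpairs_f.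
- apply: le_lt_trans; rewrite !(nonarch_absM habs) ler_wpM2l //.
  by rewrite abs_qpow_le.
Qed.

(** Both values are the sum of the double family a_i b_j^(q^i), taken by rows and by columns. *)
Lemma tau_eval_has_sum (J : eqType) a (b : J -> C) l : tauF abs q a -> has_sum abs b l ->
  has_sum abs (fun j => tau_eval abs q a (b j)) (tau_eval abs q a l).
Proof.
move=> aF bs; have [m um] := vanishing_has_sum habs hcomplete
  (vanishing_tau_terms2 aF (has_sum_vanishing bs)).
have -> : tau_eval abs q a l = m.
  apply: (has_sum_unique habs (tau_evalP l aF)).
  apply: (has_sum_fubini habs um) => i /=.
  by apply: (has_sumMl habs); exact: has_sum_qpow.
have um' : has_sum abs (fun x : J * int => a x.2 * qpow q x.2 (b x.1)) m.
  apply: (@has_sum_bij _ _ _ _ _ (fun x => (x.2, x.1)) (fun x => (x.2, x.1)) _ _ _ _ um);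
  by case.
by apply: (has_sum_fubini habs um') => j; exact: (tau_evalP (b j) aF).
Qed.

(** The pairs (i, n - i) are one antidiagonal of the double family of [vanishing_tau_terms2]. *)
Lemma tau_compP a b n : tauF abs q a -> tauF abs q b ->
  has_sum abs (fun i => a i * qpow q i (b (n - i))) (tau_comp abs q a b n).
Proof.
move=> aF bF; apply: (has_sum_zsum habs hcomplete).
apply: (@vanishing_inj _ _ _ _ _ (fun i => (i, n - i)) fst
  (fun x => a x.1 * qpow q x.1 (b x.2))) => //.
exact/vanishing_tau_terms2/vanishing_coef.
Qed.

(** The double family a_i (b_j z^(q^j))^(q^i) is summed once over j and then i, once along the
    antidiagonals i + j = n. *)
Lemma tau_comp_eval a b z : tauF abs q a -> tauF abs q b ->
  has_sum abs (tau_terms q (tau_comp abs q a b) z) (tau_eval abs q a (tau_eval abs q b z)).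
Proof.
move=> aF bF; have [m um] := vanishing_has_sum habs hcomplete
  (vanishing_tau_terms2 aF ((tauFP b).1 bF z)).
have -> : tau_eval abs q a (tau_eval abs q b z) = m.
  apply: (has_sum_unique habs (tau_evalP _ aF)).
  apply: (has_sum_fubini habs um) => i /=.
  by apply: (has_sumMl habs); apply: has_sum_qpow; exact: tau_evalP.
have um' : has_sum abs
    (fun x : int * int => a x.2 * qpow q x.2 (tau_terms q b z (x.1 - x.2))) m.
  apply: (@has_sum_bij _ _ _ _ _ (fun x => (x.2, x.1 - x.2)) (fun x => (x.1 + x.2, x.1))
    _ _ _ _ um).
  - by case=> i j /=; congr (_, _); ring.
  - by case=> i j /=; congr (_, _); ring.
apply: (has_sum_fubini habs um') => n /=.
have := has_sumMl habs (qpow q n z) (tau_compP n aF bF).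
rewrite mulrC; apply: eq_has_sum => i.
by rewrite /tau_terms qpowM qpow_qpow subrKC; ring.
Qed.

Lemma tauF_comp a b : tauF abs q a -> tauF abs q b -> tauF abs q (tau_comp abs q a b).
Proof.
move=> aF bF z; exists (tau_eval abs q a (tau_eval abs q b z)).
exact/(zsum_to_has_sum habs)/tau_comp_eval.
Qed.

Lemma tau_eval_comp a b z : tauF abs q a -> tauF abs q b ->
  tau_eval abs q (tau_comp abs q a b) z = tau_eval abs q a (tau_eval abs q b z).
Proof. by move=> aF bF; exact/zsumP/tau_comp_eval. Qed.

Lemma tau_eval0 (a : int -> C) : tau_eval abs q a 0 = 0.
Proof.
apply: (zsumP habs); rewrite (_ : tau_terms q a 0 = fun i => 0 * (if i == 0 then 0 else 0)).
  by have := has_sumMl habs 0 (has_sum_single habs (0 : int) 0); rewrite mul0r.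
by apply: funext => n; rewrite /tau_terms qpow0 mulr0 mul0r.
Qed.

(** * The adjoint *)

Lemma tau_adjE (a : int -> C) n z : tau_terms q (tau_adj q a) z n = qpow q n (a (- n) * z).
Proof. by rewrite /tau_terms /tau_adj qpowM. Qed.

(** The delicate terms are the roots (a_k z)^(1/q^k) for k large. If 0 < [abs w] <= eps, convergence
    of [a] at 1/w gives |a_k z| < |w|^(q^k), so the root is smaller than eps. At the other end,
    (a_(-k) z)^(q^k) is at most |a_(-k) z| once the latter is below 1. *)
Lemma tauF_adj (a : int -> C) : tauF abs q a -> tauF abs q (tau_adj q a).
Proof.
move=> aF; apply/tauFP => z; apply/vanishing_intP => eps e0.
have az0 := vanishingMl habs z (vanishing_coef aF).
have m0 : 0 < Num.min eps 1 by rewrite lt_min e0 ltr01.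
have [N1 hN1] := (vanishing_intP abs _).1 az0 _ m0.
have [N2 hN2] : exists N, forall k : nat, (N <= k)%N ->
    abs (qpow q (- k%:Z) (a k%:Z * z)) < eps.
  have [[w w0 we]|nw] := pselect (exists2 w, w != 0 & abs w <= eps).
  - have [N hN] := (vanishing_intP abs _).1
      (vanishingMl habs z ((tauFP a).1 aF w^-1)) 1 ltr01.
    exists N => k Nk; apply: lt_le_trans we.
    rewrite -[X in _ < abs X](qpowK k%:Z w) abs_qpow_lt.
    have qw0 : 0 < abs (qpow q k w) by rewrite (absX habs) exprn_gt0 // (abs_gt0 habs).
    have := hN k%:Z Nk; rewrite /tau_terms mulrCA mulrA (nonarch_absM habs).
    move=> h; rewrite -[ltLHS]mulr1 -(abs1 habs) -(qpow1 k%:Z) -(mulVf w0) qpowM.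
    rewrite !(nonarch_absM habs) mulrA gtr_pMl //.
    by move: h; rewrite !(nonarch_absM habs); lra.
  (* No nonzero element has absolute value at most [eps], as can happen for a trivial absolute
     value, so a product smaller than [eps] is 0. *)
  - exists N1 => k N1k; have : abs (z * a k) < eps.
      by have := hN1 k%:Z N1k; rewrite lt_min => /andP[].
    move=> h; have [az|az] := eqVneq (a k * z) 0; first by rewrite az qpow0 (abs0 habs).
    by case: nw; exists (a k * z) => //; rewrite mulrC ltW.
exists (maxn N1 N2) => -[k|k] /=; rewrite geq_max => /andP[N1k N2k]; rewrite tau_adjE.
- have := hN1 (- k%:Z); rewrite abszN => /(_ N1k); rewrite lt_min mulrC => /andP[ae a1].
  apply: le_lt_trans ae; rewrite /= (absX habs) ler_iXnr //; exact: ltW.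
- by have := hN2 k.+1 N2k; rewrite -NegzE NegzE opprK.
Qed.

(** Apply [qpow q n] to the sum for the coefficient of index -n and substitute j = n + i. *)
Lemma tau_adj_comp a b : tauF abs q a -> tauF abs q b ->
  tau_adj q (tau_comp abs q a b) = tau_comp abs q (tau_adj q b) (tau_adj q a).
Proof.
move=> aF bF; apply: funext => n.
have h1 := has_sum_qpow n (tau_compP (- n) aF bF).
have h2 := tau_compP n (tauF_adj bF) (tauF_adj aF).
apply: (has_sum_unique habs h1).
have := @has_sum_bij _ _ abs _ _ (fun i => n + i) (fun j => j - n) _ _ _ _ h2.
have c1 : cancel (fun i => n + i) (fun j => j - n) by move=> i; rewrite addrC addKr.
have c2 : cancel (fun j => j - n) (fun i => n + i) by move=> i; rewrite subrKC.
move/(_ c1 c2); apply: eq_has_sum => i.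
have e1 : n - (n + i) = - i by ring.
by rewrite /tau_adj e1 opprK qpow_qpow addrK opprD qpowM qpow_qpow mulrC.
Qed.

(* [G n] is the sum of the [u i] over [i <= n], hence minus the sum over [i > n]:
   the first form controls [n -> -oo] and the second [n -> +oo]. *)
Lemma right_div_one_sub_tau (u : int -> C) : tauF abs q u -> has_sum abs u 0 ->
  exists2 G, tauF abs q G & forall n, G n - G (n - 1) = u n.
Proof.
move=> uF u0; have uv := vanishing_coef uF.
pose lo n i : C := if i <= n then u i else 0.
have lov n : vanishing abs (lo n).
  apply: (vanishing_dominated uv) => i; rewrite /lo.
  by case: ifP => // _; rewrite (abs0 habs).
pose G n := zsum abs (lo n).
have Glo n : has_sum abs (lo n) (G n) by apply: has_sum_zsum.
have Ghi n : has_sum abs (fun i => if i <= n then 0 else - u i) (G n).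
  have := has_sumB habs (Glo n) u0; rewrite subr0; apply: eq_has_sum => i.
  by rewrite /lo; case: ifP; rewrite ?subrr ?sub0r.
exists G; last first.
  move=> n; apply: (has_sum_unique habs) (has_sum_single habs n (u n)).
  have := has_sumB habs (Glo n) (Glo (n - 1)); apply: eq_has_sum => i; rewrite /lo.
  case: ltgtP => ini.
  - have -> : i <= n - 1 by lia.
    by rewrite subrr.
  - have -> : (i <= n - 1) = false by lia.
    by rewrite subrr.
  - have -> : (i <= n - 1) = false by lia.
    by rewrite ini subr0.
apply/tauFP => z; apply/vanishing_intP => eps e0.
(* Once [abs z'] >= 1, the size of z'^(q^n) increases with n: for n >= 0 it is bounded by its size
   at any i > n, and for n < 0 by [abs z'] itself. *)
have [z' z'1 zz'] : exists2 z', 1 <= abs z' & abs z <= abs z'.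
  by have [z1|/ltW z1] := leP 1 (abs z); [exists z | exists 1; rewrite ?(abs1 habs)].
have [N1 hN1] := (vanishing_intP abs _).1 ((tauFP u).1 uF z') _ e0.
have [N2 hN2] := (vanishing_intP abs _).1 (vanishingMl habs z' uv) _ e0.
exists (maxn N1 N2) => n; rewrite geq_max => /andP[N1n N2n]; rewrite /tau_terms mulrC.
have [n0|n0] := leP 0 n.
- apply: (abs_has_sum_lt habs (has_sumMl habs (qpow q n z) (Ghi n))) => // i.
  case: ifPn; rewrite ?mulr0 ?(abs0 habs) // -ltNge mulrN (absN habs) => ni.
  apply: le_lt_trans (hN1 i _); last by lia.
  rewrite /tau_terms mulrC !(nonarch_absM habs) ler_wpM2l //.
  apply: le_trans (_ : abs (qpow q n z') <= _); first by rewrite abs_qpow_le.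
  by apply: abs_qpow_mono => //; exact: ltW.
- apply: (abs_has_sum_lt habs (has_sumMl habs (qpow q n z) (Glo n))) => // i.
  rewrite /lo; case: ifPn; rewrite ?mulr0 ?(abs0 habs) // => ni.
  apply: le_lt_trans (hN2 i _); last by lia.
  rewrite !(nonarch_absM habs) ler_wpM2r //.
  apply: le_trans (_ : abs (qpow q n z') <= _); first by rewrite abs_qpow_le.
  rewrite -[X in _ <= abs X]qpow_id; apply: abs_qpow_mono => //; exact: ltW.
Qed.

(** * The series attached to a zero, and the pairing *)

Lemma tau_comp_const (f : int -> C) alpha n :
  tau_comp abs q f (tau_const alpha) n = f n * qpow q n alpha.
Proof.
apply: (zsumP habs); apply: eq_has_sum (has_sum_single habs n _) => i.
rewrite /tau_const subr_eq0 (eq_sym n); case: eqP => [->//|_].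
by rewrite qpow0 mulr0.
Qed.

Lemma tau_comp_one_sub_tau (G : int -> C) n :
  tau_comp abs q G (@one_sub_tau C) n = G n - G (n - 1).
Proof.
apply: (zsumP habs).
apply: eq_has_sum (has_sumB habs (has_sum_single habs n (G n))
  (has_sum_single habs (n - 1) (G (n - 1)))) => i.
rewrite /one_sub_tau subr_eq0 (eq_sym n).
have -> : (n - i == 1) = (i == n - 1) by lia.
have [->|ni] := eqVneq i n.
- have -> : (n == n - 1) = false by lia.
  by rewrite qpow1 mulr1 subr0.
- case: eqP => [->|_]; first by rewrite qpowN qpow1 mulrN1 sub0r.
  by rewrite qpow0 mulr0 subrr.
Qed.

Lemma tauF_mulr_const (f : int -> C) alpha : tauF abs q f ->
  tauF abs q (fun n => f n * qpow q n alpha).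
Proof.
move=> /tauFP fF; apply/tauFP => z; have := fF (alpha * z).
congr vanishing; apply: funext => n; by rewrite /tau_terms qpowM mulrA.
Qed.

(** The coefficients of f o alpha add up to f(alpha) = 0, so [right_div_one_sub_tau] provides a
    quotient and [xget] does not fall back on its default. *)
Lemma tau_galphaP (f : int -> C) alpha : tauF abs q f -> tau_ker abs q f alpha ->
  tauF abs q (tau_galpha abs q f alpha) /\
  forall n, tau_galpha abs q f alpha n - tau_galpha abs q f alpha (n - 1) =
    f n * qpow q n alpha.
Proof.
move=> fF falpha.
have [|G GF GE] := right_div_one_sub_tau (tauF_mulr_const alpha fF).
  by have := tau_evalP alpha fF; rewrite falpha.
have : [set g | tauF abs q g /\ tau_comp abs q f (tau_const alpha) =
    tau_comp abs q g (@one_sub_tau C)] (tau_galpha abs q f alpha).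
  apply: xgetPex; exists G; split=> //; apply: funext => n.
  by rewrite tau_comp_const tau_comp_one_sub_tau GE.
case=> HF HE; split=> // n.
by rewrite -tau_comp_one_sub_tau -HE tau_comp_const.
Qed.

Lemma tau_galpha_unique (f G : int -> C) alpha : tauF abs q f -> tau_ker abs q f alpha ->
  tauF abs q G -> (forall n, G n - G (n - 1) = f n * qpow q n alpha) ->
  tau_galpha abs q f alpha = G.
Proof.
move=> fF falpha GF GE; have [HF HE] := tau_galphaP fF falpha.
set H := tau_galpha abs q f alpha in HF HE *.
have D0 : (fun n => H n - G n) = fun=> 0.
  apply: (vanishing_const0 habs).
  - have := vanishingD habs (vanishing_coef HF) (vanishingMl habs (-1) (vanishing_coef GF)).
    by congr vanishing; apply: funext => n; rewrite mulN1r.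
  - by move=> n; have := HE n; rewrite -GE => h; apply/eqP; rewrite -subr_eq0;
      apply/eqP; rewrite -(subrr (G n - G (n - 1))) -{1}h; ring.
apply: funext => n; apply/eqP; rewrite -subr_eq0; apply/eqP.
exact: (congr1 (fun D => D n) D0).
Qed.

(** By uniqueness, it suffices that h o g_alpha be a quotient of h o g o alpha by 1 - tau, which is
    associativity, checked on coefficients. *)
Lemma tau_galpha_comp (h g : int -> C) alpha : tauF abs q h -> tauF abs q g ->
  tau_ker abs q g alpha ->
  tau_galpha abs q (tau_comp abs q h g) alpha =
  tau_comp abs q h (tau_galpha abs q g alpha).
Proof.
move=> hF gF galpha; have [GF GE] := tau_galphaP gF galpha.
set G := tau_galpha abs q g alpha in GF GE *.
apply: tau_galpha_unique.
- exact: tauF_comp.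
- by rewrite /tau_ker /= tau_eval_comp // galpha tau_eval0.
- exact: tauF_comp.
move=> n; apply: (has_sum_unique habs
  (has_sumB habs (tau_compP n hF GF) (tau_compP (n - 1) hF GF))).
rewrite mulrC; have := has_sumMl habs (qpow q n alpha) (tau_compP n hF gF).
apply: eq_has_sum => i; rewrite -mulrBr -qpowB addrAC GE qpowM qpow_qpow subrKC.
by ring.
Qed.

Lemma tau_pairing_comp (h g : int -> C) alpha beta : tauF abs q h -> tauF abs q g ->
  tau_ker abs q g alpha ->
  tau_pairing abs q (tau_comp abs q h g) alpha beta =
  tau_pairing abs q g alpha (tau_eval abs q (tau_adj q h) beta).
Proof.
move=> hF gF galpha; have [GF _] := tau_galphaP gF galpha.
rewrite /tau_pairing tau_galpha_comp // tau_adj_comp //.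
by rewrite tau_eval_comp //; exact: tauF_adj.
Qed.

(** * Surjectivity of nonzero series and nondegeneracy of the pairing *)

Hypothesis he : (0 < e)%N.

Let q_gt1 : (1 < q)%N.
Proof. by rewrite hq -(exp1n e) ltn_exp2r // prime_gt1 // (pcharf_prime charC). Qed.

(* Solve the truncated equation by the smallest root of a polynomial: that root is
   at most [z0], where a single term has the size of [w], so the neglected terms are
   small at the root as well. *)
Lemma tau_eval_approx (a : int -> C) n0 w : tauF abs q a -> a n0 != 0 ->
  exists z, abs (a n0 * qpow q n0 z) <= abs w /\
    abs (w - tau_eval abs q a z) <= abs w / 2.
Proof.
move=> aF an0; have [->|w0] := eqVneq w 0.
  exists 0; rewrite qpow0 mulr0 tau_eval0 subrr.
  by rewrite !(abs0 habs) mul0r.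
pose z0 := qpow q (- n0) ((a n0)^-1 * w).
have z0E : a n0 * qpow q n0 z0 = w by rewrite /z0 qpowKV mulVKf.
have aw : 0 < abs w / 2 by rewrite divr_gt0 // (abs_gt0 habs).
(* Beyond [N'] the terms at [z0] are below half of [abs w]; [N] also exceeds |n0|, so that the
   truncation keeps the index [n0]. *)
have [N' hN'] := (vanishing_intP abs _).1 ((tauFP a).1 aF z0) _ aw.
pose N := maxn N' (`|n0|).+1.
(* The truncation to -N <= i < N, minus [w], in the variable y with z = y^(q^N), which makes all
   exponents q^(i + N) integers. *)
pose P : {poly C} := \sum_(j < N.*2) a (j%:Z - N%:Z) *: 'X^(q ^ j) - w%:P.
have PE y : P.[y] = \sum_(j < N.*2) tau_terms q a (qpow q N y) (j%:Z - N%:Z) - w.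
  rewrite /P !hornerE horner_sum; congr (_ - _); apply: eq_bigr => j _.
  by rewrite hornerZ hornerXn /tau_terms qpow_qpow subrK.
have P0 : P`_0 = - w.
  rewrite coefB coefC eqxx coef_sum big1 ?sub0r // => j _.
  by rewrite coefZ coefXn ltn_eqF ?mulr0 // expn_gt0 ltnW.
pose j0 := absz (n0 + N%:Z).
have j0E : j0%:Z = n0 + N%:Z by rewrite /j0; lia.
have j0N : (j0 < N.*2)%N by rewrite /j0; lia.
have Pj0 : P`_(q ^ j0) = a n0.
  (* Since q > 1, distinct j give distinct exponents q^j, so a single summand contributes. *)
  rewrite coefB coefC gtn_eqF ?expn_gt0 ?(ltnW q_gt1) // subr0 coef_sum.
  rewrite (bigD1 (Ordinal j0N)) //= big1 ?addr0 => [|j jj0].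
    by rewrite coefZ coefXn eqxx mulr1 j0E addrK.
  rewrite coefZ coefXn eqn_exp2l // eq_sym.
  suff -> : (j == j0 :> nat) = false by rewrite mulr0.
  by apply/negbTE; apply: contra jj0 => /eqP jj0; apply/eqP/val_inj.
pose y0 := qpow q (- N%:Z) z0.
have [||||y Py yy0] := @small_root C R abs habs P (abs y0) (q ^ j0).
- exact: abs_ge0.
- apply/eqP => PE0; move: P0; rewrite PE0 coef0 => /esym/eqP.
  by rewrite oppr_eq0 (negPf w0).
- by rewrite expn_gt0 ltnW.
- rewrite P0 Pj0 (absN habs) -(absX habs) -(nonarch_absM habs).
  rewrite -[y0 ^+ _]/(qpow q j0 y0) /y0 qpow_qpow.
  by rewrite j0E addrK z0E.
pose z := qpow q N y; exists z.
have zz0 : abs z <= abs z0.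
  by rewrite -(qpowKV N z0) /z abs_qpow_le.
have term_le i : abs (tau_terms q a z i) <= abs (tau_terms q a z0 i).
  by rewrite !(nonarch_absM habs) ler_wpM2l // abs_qpow_le.
split; first by rewrite -[X in _ <= abs X]z0E; exact: term_le.
pose A := [seq (nat_of_ord j)%:Z - N%:Z | j <- enum 'I_(N.*2)].
have sA : \sum_(i <- A) tau_terms q a z i = w.
  by move: Py; rewrite rootE PE subr_eq0 => /eqP <-; rewrite big_map big_enum.
rewrite -{1}sA; apply/ltW/(has_sum_approx habs (tau_evalP z aF)) => //.
- by rewrite map_inj_uniq ?enum_uniq // => i j /addIr[] /val_inj.
- move=> i iA; apply: le_lt_trans (term_le i) (hN' i _); rewrite leqNgt.
  apply: contra iA => iN'; apply/mapP.
  have iN : (absz (i + N%:Z)%R < N.*2)%N by lia.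
  by exists (Ordinal iN); rewrite ?mem_enum //=; lia.
Qed.

(** The residues [w k] at least halve in size at each step. The bound on the term of index [n0]
    forces the corrections [zf (w k)] to tend to 0, and at their sum the value of the series
    telescopes to [w 0] = c. *)
Lemma tau_eval_surjective (a : int -> C) c : tauF abs q a -> a <> (fun=> 0) ->
  exists z, tau_eval abs q a z = c.
Proof.
move=> aF a0.
have [n0 an0] : exists n0, a n0 != 0.
  apply/not_existsP => an; apply: a0; apply: funext => n; apply/eqP.
  by have /negP := an n; rewrite negbK.
have /choice[zf zfP] := fun w => tau_eval_approx w aF an0.
pose w k := iter k (fun w => w - tau_eval abs q a (zf w)) c.
have wle k : abs (w k) <= abs c / 2 ^+ k.
  elim: k => [|k IH]; first by rewrite expr0 divr1.
  apply: le_trans (zfP (w k)).2 _; rewrite exprSr invfM mulrA.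
  by rewrite ler_wpM2r ?invr_ge0.
have ws eps : 0 < eps -> exists N, forall k, (N <= k)%N -> abs (w k) < eps.
  move=> e0; exists (Num.bound (abs c / eps)) => k /upper_nthrootP.
  rewrite ltr_pdivrMr // => h; apply: le_lt_trans (wle k) _.
  by rewrite ltr_pdivrMr ?exprn_gt0 // mulrC.
have zs : vanishing abs (fun k => zf (w k)).
  move=> eps e0; have [d d0 hd] := qpow_small (- n0) e0.
  have [d' d'0 hd'] := mulr_small habs (a n0)^-1 d0.
  have [N hN] := ws _ d'0; exists (iota 0 N) => k; rewrite mem_iota /= -leqNgt => Nk.
  rewrite -(qpowK n0 (zf (w k))); apply: hd.
  rewrite -(mulKf an0 (qpow q n0 _)); apply: hd'.
  exact: le_lt_trans (zfP (w k)).1 (hN _ Nk).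
have [z hz] := vanishing_has_sum habs hcomplete zs; exists z.
apply: (has_sum_unique habs (tau_eval_has_sum aF hz)).
apply: eq_has_sum (has_sum_telescope habs ws) => k /=.
by rewrite opprB subrKC.
Qed.

(* Let [K := g_gamma] for [g^*] and [k := K^*]: then [gamma g = (1 - tau^-1) k], and
   [k] is onto, so it takes the value 1 at some [alpha], necessarily in [ker g].
   Let [G := g_alpha] for [g], [X := gamma G] and [Z := - tau^-1 k alpha], so that [X (1 - tau) = (1 - tau) Z]
   and [Z 1 = -1].  Dividing [Z + 1 = W (1 - tau)] gives [X = -1 + (1 - tau) W], and
   the pairing is [X^* 1 = -1 + W^* (1 - tau^-1) 1 = -1]. *)
Lemma tau_pairing_nondegenerate (g : int -> C) gamma : tauF abs q g -> g <> (fun=> 0) ->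
  gamma != 0 -> tau_ker abs q (tau_adj q g) gamma ->
  exists2 alpha, tau_ker abs q g alpha & tau_pairing abs q g alpha gamma = -1.
Proof.
move=> gF g0 gamma0 hgamma.
have adjF a (aF : tauF abs q a) := tauF_adj aF.
have qpQ m n (x : C) := qpow_qpow m n x.
have [KF KE] := tau_galphaP (adjF _ gF) hgamma.
set K := tau_galpha _ _ _ _ in KF KE.
pose k := tau_adj q K; have kF : tauF abs q k := adjF _ KF.
have kE n : k n - qpow q (-1) (k (n + 1)) = gamma * g n.
  rewrite /k /tau_adj qpQ.
  have -> : - (n + 1) = - n - 1 by ring.
  have -> : -1 + (n + 1) = n by ring.
  rewrite -qpowB KE /tau_adj opprK qpowM !qpowKV.
  exact: mulrC.
have k0 : k <> (fun=> 0).
  move=> k0; apply: g0; apply: funext => n; apply: (mulfI gamma0).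
  by rewrite -kE k0 qpow0 subr0 mulr0.
have [alpha kalpha] := tau_eval_surjective 1 kF k0.
pose Y := tau_terms q k alpha.
have Y1 : has_sum abs Y 1 by rewrite -kalpha; exact: tau_evalP.
have shiftK : cancel (fun n : int => n + 1) (fun n => n - 1) by move=> n; rewrite addrK.
have shiftKV : cancel (fun n : int => n - 1) (fun n => n + 1) by move=> n; rewrite subrK.
have qY1 : has_sum abs (fun n => qpow q (-1) (Y (n + 1))) 1.
  rewrite -[X in has_sum _ _ X](qpow1 (-1)).
  apply: has_sum_qpow.
  exact: has_sum_bij shiftK shiftKV Y1.
have YE n : gamma * (g n * qpow q n alpha) = Y n - qpow q (-1) (Y (n + 1)).
  rewrite mulrA -kE /Y /tau_terms qpowM qpQ addrCA subrr addr0.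
  by rewrite mulrBl.
have galpha : tau_ker abs q g alpha.
  apply: (mulfI gamma0); rewrite mulr0 -(subrr 1).
  apply: (has_sum_unique habs) (has_sumB habs Y1 qY1).
  apply: eq_has_sum YE _; apply: (has_sumMl habs).
  exact: tau_evalP.
exists alpha => //.
have [GF GE] := tau_galphaP gF galpha.
rewrite /tau_pairing; set G := tau_galpha _ _ _ _ in GF GE *.
pose delta (n : int) : C := if n == 0 then 1 else 0.
have qdelta m n : qpow q m (delta n) = delta n.
  by rewrite /delta; case: ifP; rewrite ?qpow1 ?qpow0.
have deltas : has_sum abs delta 1 by exact: has_sum_single.
(* The coefficients of 1 + Z; their sum is 1 + Z(1) = 0, as the division by 1 - tau demands. *)
pose u n := delta n - qpow q (-1) (Y (n + 1)).
have uF : tauF abs q u.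
  apply/tauFP => z.
  have YF := tauF_mulr_const alpha kF.
  have Yz := (tauFP _).1 YF z.
  have := vanishingD habs (has_sum_vanishing (has_sum_single habs (0 : int) z))
    (vanishingMl habs (-1) (vanishing_qpow (-1) (vanishing_inj shiftK Yz))).
  congr vanishing; apply: funext => n; rewrite /tau_terms /u mulrBl.
  rewrite (qpowM _ (k _ * _)) qpQ addrCA subrr addr0 mulN1r.
  congr (_ - _); rewrite /delta; case: eqP => [->|_]; last by rewrite mul0r.
  by rewrite mul1r qpow_id.
have u0 : has_sum abs u 0 by rewrite -(subrr 1); exact: has_sumB.
have [W WF WE] := right_div_one_sub_tau uF u0.
have XE n : gamma * G n = - delta n + W n - qpow q 1 (W (n - 1)).
  apply/eqP; rewrite -subr_eq0; apply/eqP.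
  (* Both sides have the same product with 1 - tau on the right, so [vanishing_const0] applies to
     their difference. *)
  pose D n := gamma * G n - (- delta n + W n - qpow q 1 (W (n - 1))).
  suff D0 : D = fun=> 0 by exact: (congr1 (fun D => D n) D0).
  apply: (vanishing_const0 habs) => [|m].
  - have cV a (aF : tauF abs q a) := vanishing_coef aF.
    have WV := vanishing_qpow 1 (vanishing_inj shiftKV (cV _ WF)).
    have := vanishingD habs (vanishingMl habs gamma (cV _ GF)) (vanishingD habs
      (has_sum_vanishing deltas) (vanishingD habs (vanishingMl habs (-1) (cV _ WF)) WV)).
    by congr vanishing; apply: funext => i; rewrite /D; ring.
  apply/eqP; rewrite -subr_eq0; apply/eqP.
  have Xm : gamma * G m - gamma * G (m - 1) = Y m - qpow q (-1) (Y (m + 1)).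
    by rewrite -mulrBr GE YE.
  have Wm : W m - W (m - 1) = delta m - qpow q (-1) (Y (m + 1)) := WE m.
  have Wm1 : qpow q 1 (W (m - 1)) - qpow q 1 (W (m - 1 - 1)) = delta (m - 1) - Y m.
    rewrite -qpowB WE /u qpowB qdelta qpQ addrN qpow_id.
    by rewrite subrK.
  rewrite /D; transitivity ((gamma * G m - gamma * G (m - 1)) - (W m - W (m - 1)) +
    (qpow q 1 (W (m - 1)) - qpow q 1 (W (m - 1 - 1))) + delta m - delta (m - 1)); first ring.
  by rewrite Xm Wm Wm1; ring.
apply: (zsumP habs).
(* [V1] and its shift [V2] both add up to the value of the adjoint of [W] at 1 and cancel; only the
   -1 coming from [delta] survives. *)
have V1 := tau_evalP 1 (adjF _ WF).
have V2 := has_sum_bij shiftK shiftKV V1.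
have := has_sumD habs (has_sumN habs deltas) (has_sumB habs V1 V2).
rewrite subrr addr0; apply: eq_has_sum => n.
rewrite !tau_adjE !mulr1 [G _ * _]mulrC XE.
rewrite !(qpowB, qpowD, qpowN) qdelta qpQ opprD -!addrA.
congr (- _ + _); by rewrite /delta oppr_eq0.
Qed.

End TauSeriesTheory.

Theorem proposition8p8 (R : realType) (p e q : nat) (hp : prime p)
    (he : (0 < e)%N) (hq : q = (p ^ e)%N)
    (Fq : finFieldType) (hFq : #|Fq| = q)
    (C : closedFieldType) (iota : {rmorphism Fq -> C})
    (abs : C -> R) (habs : nonarch_abs abs) (hcomplete : abs_complete abs)
    (h g f : int -> C) (hF : tauF abs q h) (gF : tauF abs q g)
    (h_neq0 : h <> (fun=> 0)) (g_neq0 : g <> (fun=> 0))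
    (hf : f = tau_comp abs q h g) :
  [set beta | tau_ker abs q (tau_adj q f) beta /\
     forall alpha, tau_ker abs q g alpha ->
       tau_pairing abs q f alpha beta = 0]
  = tau_ker abs q (tau_adj q h).
Proof.
have charC : p \in [pchar C].
  by apply: (rmorph_pchar iota); apply: (@card_finPcharP _ _ e); rewrite ?hFq.
have adjF a (aF : tauF abs q a) := tauF_adj charC hq habs hcomplete aF.
have adj_eval beta : tau_eval abs q (tau_adj q f) beta =
    tau_eval abs q (tau_adj q g) (tau_eval abs q (tau_adj q h) beta).
  rewrite hf (tau_adj_comp charC hq habs hcomplete hF gF).
  by rewrite (tau_eval_comp charC hq habs hcomplete) //; exact: adjF.
apply/seteqP; split=> beta /=.
(* If gamma = h^* beta were nonzero, some alpha in ker g would pair with it to -1, while the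
   assumption on beta makes this pairing 0. *)
- case=> fbeta pbeta; apply: contrapT => /eqP gamma0.
  rewrite /tau_ker /= adj_eval in fbeta.
  have [alpha galpha] :=
    tau_pairing_nondegenerate charC hq habs hcomplete he gF g_neq0 gamma0 fbeta.
  rewrite -(tau_pairing_comp charC hq habs hcomplete _ hF gF galpha) -hf pbeta //.
  by move/eqP; rewrite eq_sym oppr_eq0 oner_eq0.
- rewrite /tau_ker /= => hbeta; split; first by rewrite adj_eval hbeta (tau_eval0 charC hq habs).
  move=> alpha galpha; rewrite hf (tau_pairing_comp charC hq habs hcomplete _ hF gF galpha).
  by rewrite hbeta /tau_pairing (tau_eval0 charC hq habs).
Qed.
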